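(* Consider the complex 3-dimensional Novikov algebras $D_1$, $D_2(\alpha)$ $(\alpha\in\mathbb{C})$ and $B_1$, $B_2$, $B_3$, $B_4(\alpha)$ $(\alpha\in\mathbb{C})$, $B_5(\beta)$ $(\beta\in\mathbb{C})$ given by the products listed in the context. For $A$ in the first list (type $D$) and $B$ in the second list (type $B$), $B$ lies in $\partial O(A)$ if and only if $B$ is isomorphic to one of the algebras given for $A$ below: \begin{itemize} \item $A=D_1$: $B_4(0)$, $B_5(0)$; \item $A=D_2(\alpha)$ with $\alpha\neq-1$: $B_4(0)$, $B_5(0)$; \item $A=D_2(-1)$: $B_5(0)$. \end{itemize}
   Context: A Novikov algebra over $\mathbb{C}$ is a complex vector space with a bilinear product satisfying $(x\cdot y)\cdot z-x\cdot(y\cdot z)=(y\cdot x)\cdot z-y\cdot(x\cdot z)$ and $(x\cdot y)\cdot z=(x\cdot z)\cdot y$ for all $x,y,z$. Fix a 3-dimensional complex vector space $V$ with basis $(e_1,e_2,e_3)$. The set of Novikov products on $V$, identified with their structure constants in $\mathbb{C}^{27}$, is an affine algebraic set, on which $GL_3(\mathbb{C})$ acts by $(g\circ\mu)(x,y)=g(\mu(g^{-1}x,g^{-1}y))$. For a 3-dimensional Novikov algebra $A$, $O(A)$ is the orbit of a structure representing $A$, $\overline{O(A)}$ its Zariski closure, and $\partial O(A)=\overline{O(A)}\setminus O(A)$; ''$B$ lies in $\partial O(A)$'' means that a structure representing $B$ lies in $\partial O(A)$. The algebras (basis $e_1,e_2,e_3$; products of basis vectors not listed are zero): $D_1$: $e_1e_1=-e_1+e_3$,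 $e_1e_3=e_2$, $e_2e_1=-e_2$, $e_3e_1=-e_3$. $D_2(\alpha)$: $e_1e_1=\alpha e_1$, $e_1e_2=(\alpha+1)e_2$, $e_1e_3=e_2+(\alpha+1)e_3$, $e_2e_1=\alpha e_2$, $e_3e_1=\alpha e_3$. $B_1$: $e_1e_1=e_1$, $e_1e_2=e_2+e_3$, $e_1e_3=e_3$, $e_2e_1=e_2$, $e_3e_1=e_3$. $B_2$: $e_1e_1=e_1$, $e_1e_2=e_2+e_3$, $e_1e_3=e_3$, $e_2e_1=e_2$, $e_2e_2=e_3$, $e_3e_1=e_3$. $B_3$: $e_1e_2=\frac12e_3$, $e_2e_1=-\frac12e_3$, $e_2e_2=e_3$. $B_4(\alpha)$: $e_1e_2=\alpha e_3$, $e_2e_1=(\alpha-1)e_3$, $e_2e_2=e_1$. $B_5(\beta)$: $e_1e_2=\beta e_3$, $e_2e_1=(\beta-1)e_3$. The only isomorphisms among these algebras are $B_5(\beta)\cong B_5(1-\beta)$. *)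

(* Defs.v *)
From mathcomp Require Import all_boot all_order all_algebra.
From mathcomp Require Import mpoly ring.

Set Implicit Arguments.
Unset Strict Implicit.
Unset Printing Implicit Defensive.

Import GRing.Theory.
Local Open Scope ring_scope.

Section Novikov.
Variable K : fieldType.

Local Notation V := 'cV[K]_3.

(* The basis of V is e 1, e 2, e 3, while ordinals count from 0; hence the    *)
(* shifts below.                                                              *)
Definition e (m : nat) : V := \col_(k < 3) (k.+1 == m)%:R.

(* A bilinear product on V as a point c of K^27: c (i, j, k) is the           *)
(* coefficient of e k.+1 in the product of e i.+1 and e j.+1.                 *)
Definition sconsts := {ffun 'I_3 * 'I_3 * 'I_3 -> K}.

Definition mul (c : sconsts) (x y : V) : V :=
  \col_k \sum_i \sum_j x i 0 * y j 0 * c (i, j, k).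

Definition table (f : nat -> nat -> V) : sconsts :=
  [ffun t : 'I_3 * 'I_3 * 'I_3 => f t.1.1.+1 t.1.2.+1 t.2 0].

Definition novikov (c : sconsts) : Prop :=
  (forall x y z : V, mul c (mul c x y) z - mul c x (mul c y z) =
                     mul c (mul c y x) z - mul c y (mul c x z)) /\
  (forall x y z : V, mul c (mul c x y) z = mul c (mul c x z) y).

Record novikovAlg := NovikovAlg {
  alg_sconsts :> sconsts;
  _ : novikov alg_sconsts }.

Definition isomorphic (c d : sconsts) : Prop :=
  exists2 g : 'M[K]_3, g \in unitmx &
    forall x y : V, g *m mul c x y = mul d (g *m x) (g *m y).

Definition act (g : 'M[K]_3) (c : sconsts) : sconsts :=
  table (fun i j => g *m mul c (invmx g *m e i) (invmx g *m e j)).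

Definition orbit (c d : sconsts) : Prop :=
  exists2 g : 'M[K]_3, g \in unitmx & d = act g c.

(* The variables of a polynomial on K^27 are numbered by the enumeration of   *)
(* the index triples.                                                         *)
Local Notation poly27 := {mpoly K[#|{: 'I_3 * 'I_3 * 'I_3}|]}.

Definition peval (p : poly27) (c : sconsts) : K :=
  p.@[fun m => c (enum_val m)].

Definition zariski_closed (Z : sconsts -> Prop) : Prop :=
  exists P : poly27 -> Prop, forall c, Z c <-> (forall p, P p -> peval p c = 0).

(* The closure is taken in K^27; since the Novikov identities are polynomial  *)
(* in c, this is also the closure inside the variety of Novikov products.     *)
Definition zariski_closure (S : sconsts -> Prop) (c : sconsts) : Prop :=
  forall Z, zariski_closed Z -> (forall d, S d -> Z d) -> Z c.

Definition boundary (A c : sconsts) : Prop :=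
  zariski_closure (orbit A) c /\ ~ orbit A c.

Definition lies_in_boundary (B A : novikovAlg) : Prop :=
  exists2 c : sconsts, isomorphic c B & boundary A c.

Definition D1_table : sconsts := table (fun i j => match i, j with
  | 1%N, 1%N => - e 1 + e 3
  | 1%N, 3%N => e 2
  | 2%N, 1%N => - e 2
  | 3%N, 1%N => - e 3
  | _, _ => 0
  end).

Definition D2_table (a : K) : sconsts := table (fun i j => match i, j with
  | 1%N, 1%N => a *: e 1
  | 1%N, 2%N => (a + 1) *: e 2
  | 1%N, 3%N => e 2 + (a + 1) *: e 3
  | 2%N, 1%N => a *: e 2
  | 3%N, 1%N => a *: e 3
  | _, _ => 0
  end).

Definition B1_table : sconsts := table (fun i j => match i, j with
  | 1%N, 1%N => e 1
  | 1%N, 2%N => e 2 + e 3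
  | 1%N, 3%N => e 3
  | 2%N, 1%N => e 2
  | 3%N, 1%N => e 3
  | _, _ => 0
  end).

Definition B2_table : sconsts := table (fun i j => match i, j with
  | 1%N, 1%N => e 1
  | 1%N, 2%N => e 2 + e 3
  | 1%N, 3%N => e 3
  | 2%N, 1%N => e 2
  | 2%N, 2%N => e 3
  | 3%N, 1%N => e 3
  | _, _ => 0
  end).

Definition B3_table : sconsts := table (fun i j => match i, j with
  | 1%N, 2%N => 2^-1 *: e 3
  | 2%N, 1%N => - 2^-1 *: e 3
  | 2%N, 2%N => e 3
  | _, _ => 0
  end).

Definition B4_table (a : K) : sconsts := table (fun i j => match i, j with
  | 1%N, 2%N => a *: e 3
  | 2%N, 1%N => (a - 1) *: e 3
  | 2%N, 2%N => e 1
  | _, _ => 0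
  end).

Definition B5_table (b : K) : sconsts := table (fun i j => match i, j with
  | 1%N, 2%N => b *: e 3
  | 2%N, 1%N => (b - 1) *: e 3
  | _, _ => 0
  end).

Lemma ord3_ind (P : 'I_3 -> Prop) : P 0 -> P 1 -> P 2%:R -> forall k, P k.
Proof.
move=> P0 P1 P2 k; have [|] := eqVneq k 0; first by move=> ->.
have [|] := eqVneq k 1; first by move=> ->.
by case: k => [[|[|[|//]]] hk] // _ _; rewrite (_ : Ordinal hk = 2%:R) //;
  apply: val_inj.
Qed.

Lemma mul_table f (x y : V) k :
  mul (table f) x y k 0 =
    x 0 0 * y 0 0 * f 1 1 k 0 + x 0 0 * y 1 0 * f 1 2 k 0 +
    x 0 0 * y 2%:R 0 * f 1 3 k 0 +
    (x 1 0 * y 0 0 * f 2 1 k 0 + x 1 0 * y 1 0 * f 2 2 k 0 +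
    x 1 0 * y 2%:R 0 * f 2 3 k 0) +
    (x 2%:R 0 * y 0 0 * f 3 1 k 0 + x 2%:R 0 * y 1 0 * f 3 2 k 0 +
    x 2%:R 0 * y 2%:R 0 * f 3 3 k 0).
Proof.
rewrite mxE.
have sum3 (F : 'I_3 -> K) : \sum_i F i = F 0 + F 1 + F 2%:R.
  rewrite !big_ord_recl big_ord0 addr0 addrA.
  by congr (F _ + F _ + F _); apply: val_inj.
by rewrite !sum3 !ffunE.
Qed.

Lemma subE (x y : V) k : (x - y) k 0 = x k 0 - y k 0.
Proof. by rewrite !mxE. Qed.

Ltac mul_tac := do !split; rewrite mul_table !mxE /=; ring.

Ltac novikov_tac mulE :=
  split=> x y z; apply/colP; apply: ord3_ind; rewrite ?subE !mulE; ring.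

Lemma D1_mul (x y : V) :
  (mul D1_table x y 0 0 = - (x 0 0 * y 0 0)) *
  (mul D1_table x y 1 0 = x 0 0 * y 2%:R 0 - x 1 0 * y 0 0) *
  (mul D1_table x y 2%:R 0 =
     x 0 0 * y 0 0 - x 2%:R 0 * y 0 0).
Proof. mul_tac. Qed.

Lemma D1_novikov : novikov D1_table.
Proof. novikov_tac D1_mul. Qed.

Lemma D2_mul a (x y : V) :
  (mul (D2_table a) x y 0 0 = a * x 0 0 * y 0 0) *
  (mul (D2_table a) x y 1 0 = (a + 1) * x 0 0 * y 1 0 + x 0 0 * y 2%:R 0 + a * x 1 0 * y 0 0) *
  (mul (D2_table a) x y 2%:R 0 =
     (a + 1) * x 0 0 * y 2%:R 0 + a * x 2%:R 0 * y 0 0).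
Proof. mul_tac. Qed.

Lemma D2_novikov a : novikov (D2_table a).
Proof. novikov_tac (D2_mul a). Qed.

Lemma B1_mul (x y : V) :
  (mul B1_table x y 0 0 = x 0 0 * y 0 0) *
  (mul B1_table x y 1 0 = x 0 0 * y 1 0 + x 1 0 * y 0 0) *
  (mul B1_table x y 2%:R 0 =
     x 0 0 * y 1 0 + x 0 0 * y 2%:R 0 + x 2%:R 0 * y 0 0).
Proof. mul_tac. Qed.

Lemma B1_novikov : novikov B1_table.
Proof. novikov_tac B1_mul. Qed.

Lemma B2_mul (x y : V) :
  (mul B2_table x y 0 0 = x 0 0 * y 0 0) *
  (mul B2_table x y 1 0 = x 0 0 * y 1 0 + x 1 0 * y 0 0) *
  (mul B2_table x y 2%:R 0 =
     x 0 0 * y 1 0 + x 0 0 * y 2%:R 0 + x 1 0 * y 1 0 + x 2%:R 0 * y 0 0).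
Proof. mul_tac. Qed.

Lemma B2_novikov : novikov B2_table.
Proof. novikov_tac B2_mul. Qed.

Lemma B3_mul (x y : V) :
  (mul B3_table x y 0 0 = 0) *
  (mul B3_table x y 1 0 = 0) *
  (mul B3_table x y 2%:R 0 =
     2^-1 * x 0 0 * y 1 0 - 2^-1 * x 1 0 * y 0 0 + x 1 0 * y 1 0).
Proof. mul_tac. Qed.

Lemma B3_novikov : novikov B3_table.
Proof. novikov_tac B3_mul. Qed.

Lemma B4_mul a (x y : V) :
  (mul (B4_table a) x y 0 0 = x 1 0 * y 1 0) *
  (mul (B4_table a) x y 1 0 = 0) *
  (mul (B4_table a) x y 2%:R 0 =
     a * x 0 0 * y 1 0 + (a - 1) * x 1 0 * y 0 0).
Proof. mul_tac. Qed.

Lemma B4_novikov a : novikov (B4_table a).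
Proof. novikov_tac (B4_mul a). Qed.

Lemma B5_mul b (x y : V) :
  (mul (B5_table b) x y 0 0 = 0) *
  (mul (B5_table b) x y 1 0 = 0) *
  (mul (B5_table b) x y 2%:R 0 =
     b * x 0 0 * y 1 0 + (b - 1) * x 1 0 * y 0 0).
Proof. mul_tac. Qed.

Lemma B5_novikov b : novikov (B5_table b).
Proof. novikov_tac (B5_mul b). Qed.

Definition D1 : novikovAlg := NovikovAlg D1_novikov.
Definition D2 (a : K) : novikovAlg := NovikovAlg (D2_novikov a).
Definition B1 : novikovAlg := NovikovAlg B1_novikov.
Definition B2 : novikovAlg := NovikovAlg B2_novikov.
Definition B3 : novikovAlg := NovikovAlg B3_novikov.
Definition B4 (a : K) : novikovAlg := NovikovAlg (B4_novikov a).
Definition B5 (b : K) : novikovAlg := NovikovAlg (B5_novikov b).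

Inductive typeB : novikovAlg -> Prop :=
  | typeB1 : typeB B1
  | typeB2 : typeB B2
  | typeB3 : typeB B3
  | typeB4 a : typeB (B4 a)
  | typeB5 b : typeB (B5 b).

End Novikov.
Arguments D1 {K}.
Arguments B1 {K}.
Arguments B2 {K}.
Arguments B3 {K}.

(* Main.v *)
Require Import Defs.
From mathcomp Require Import all_boot all_order all_algebra.
From mathcomp Require Import complex reals.
From mathcomp Require Import mpoly ring.
(* Restores the name mul, which the fraction library also defines. *)
Import Defs.

(** Every algebra of type D has a product of the form
      x . y = phi(x) T y + a phi(y) x
    with phi a nonzero linear form, T an endomorphism with phi T = 0, and a a
    scalar (split_product): for D1, a = -1 and T is nilpotent of rank 2; for
    D2(alpha), a = alpha and T has a Jordan block of size 2 at alpha + 1.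

    Degenerations to type B that do not exist.  The form phi may tend to zero,
    so the shape above does not survive in the closure; but phi can be
    eliminated.  The traces of left and right multiplications satisfy
    tr L_x = (tr T + a) phi(x) and tr R_y = 3 a phi(y), so the linear relation
    3 a tr L = (tr T + a) tr R holds on the orbit (trace_ratio).  Moreover the
    bilinear map 3 x . y - tr(R_y) x, the defect, equals 3 phi(x) T y: it is
    the product of a function of x and a function of y (rank_one_defect), and
    composing it with itself gives zero when T T = 0 (square_zero_defect), as
    happens for D2(-1).  These three conditions are polynomial in the structure
    constants and invariant under isomorphism, so they pass to every algebra in
    the closure of the orbit.  The trace relation excludes B1 and B2, where
    tr L = tr R is not 0, because 2 a <> tr T for type D.  In B3, B4 and B5
    the traces vanish, so the defect is 3 times the product; it being of rank
    one excludes B3, and leaves only B4(0), B5(0) and B5(1), which is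
    isomorphic to B5(0).  Finally, left multiplication by e2 in B4(0) maps
    e2 to e1 and e1 to -e3, which excludes B4(0) for D2(-1).

    Degenerations that exist.  Each is realized by a straight line c + t d in
    the space of structure constants that starts at the limit c and lies in the
    orbit for t <> 0.  In the limit phi tends to zero while T blows up: one
    takes phi = t e2* and T = S / t + S', where e2* S is the left
    multiplication of the limit (S : e1 -> -e3, and e2 -> e1 for B4(0)) and
    S' is chosen so that T is conjugate to the operator of the algebra
    of type D.  A polynomial vanishing on the line off t = 0 vanishes at t = 0
    (closure_line).  The limits do not lie in the orbit, as their left and right
    multiplications have trace zero, contrary to those of the algebras of type
    D. *)

Set Implicit Arguments.
Unset Strict Implicit.
Unset Printing Implicit Defensive.

Import GRing.Theory Num.Theory.
Local Open Scope ring_scope.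

(** * Bilinear products and isomorphisms *)

Section Products.
Variable K : fieldType.
Local Notation V := 'cV[K]_3.
Implicit Types (c d : sconsts K) (x y : V) (g : 'M[K]_3).

Lemma sum3 (F : 'I_3 -> K) : \sum_i F i = F 0 + F 1 + F 2%:R.
Proof.
rewrite !big_ord_recl big_ord0 addr0 addrA.
by congr (F _ + F _ + F _); apply: val_inj.
Qed.

Lemma sum_eE (F : 'I_3 -> K) (i : 'I_3) : \sum_j e K i.+1 j 0 * F j = F i.
Proof.
rewrite (bigD1 i) //= big1 ?addr0 => [|j neq_ji]; rewrite !mxE ?eqxx ?mul1r //.
by rewrite eqSS -val_eqE /= in neq_ji *; rewrite (negbTE neq_ji) mul0r.
Qed.

Lemma mul_el c (i : 'I_3) y k : mul c (e K i.+1) y k 0 = \sum_j y j 0 * c (i, j, k).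
Proof.
rewrite mxE -(sum_eE (fun i' => \sum_j y j 0 * c (i', j, k))).
apply: eq_bigr => i' _; rewrite big_distrr; apply: eq_bigr => j _ /=.
by rewrite mulrA.
Qed.

Lemma mul_er c x (j : 'I_3) k : mul c x (e K j.+1) k 0 = \sum_i x i 0 * c (i, j, k).
Proof.
rewrite mxE; apply: eq_bigr => i _; rewrite -(sum_eE (fun j' => c (i, j', k))).
by rewrite big_distrr; apply: eq_bigr => j' _ /=; rewrite mulrA.
Qed.

Lemma mulEl c x y k : mul c x y k 0 = \sum_i x i 0 * mul c (e K i.+1) y k 0.
Proof.
rewrite mxE; apply: eq_bigr => i _; rewrite mul_el big_distrr.
by apply: eq_bigr => j _ /=; rewrite mulrA.
Qed.

Lemma mulEr c x y k : mul c x y k 0 = \sum_j y j 0 * mul c x (e K j.+1) k 0.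
Proof.
rewrite mxE exchange_big; apply: eq_bigr => j _; rewrite mul_er big_distrr.
by apply: eq_bigr => i _ /=; rewrite mulrCA mulrA.
Qed.

Lemma mul_e c (i j : 'I_3) k : mul c (e K i.+1) (e K j.+1) k 0 = c (i, j, k).
Proof. by rewrite mul_el; exact: sum_eE. Qed.

Lemma eq_sconsts c d : (forall x y, mul c x y = mul d x y) -> c = d.
Proof. by move=> eq_cd; apply/ffunP=> -[[i j] k]; rewrite -!mul_e eq_cd. Qed.

Definition Lmx c x : 'M[K]_3 := \matrix_(k, j) mul c x (e K j.+1) k 0.
Definition Rmx c y : 'M[K]_3 := \matrix_(k, i) mul c (e K i.+1) y k 0.

Lemma mul_Lmx c x y : mul c x y = Lmx c x *m y.
Proof.
apply/colP => k; rewrite mulEr [RHS]mxE; apply: eq_bigr => j _.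
by rewrite [Lmx _ _ _ _]mxE mulrC.
Qed.

Lemma mul_Rmx c x y : mul c x y = Rmx c y *m x.
Proof.
apply/colP => k; rewrite mulEl [RHS]mxE; apply: eq_bigr => j _.
by rewrite [Rmx _ _ _ _]mxE mulrC.
Qed.

Lemma eq_mulmx_col (A B : 'M[K]_3) : (forall y : V, A *m y = B *m y) -> A = B.
Proof.
move=> AB; apply/matrixP => i j; move/colP/(_ i): (AB (delta_mx j 0)).
by rewrite -!colE !mxE.
Qed.

Definition iso_by g c d :=
  forall x y, g *m mul c x y = mul d (g *m x) (g *m y).

Lemma iso_Lmx g c d x : iso_by g c d -> g *m Lmx c x = Lmx d (g *m x) *m g.
Proof.
by move=> g_iso; apply: eq_mulmx_col => y; rewrite -!mulmxA -!mul_Lmx g_iso.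
Qed.

Lemma iso_Rmx g c d y : iso_by g c d -> g *m Rmx c y = Rmx d (g *m y) *m g.
Proof.
by move=> g_iso; apply: eq_mulmx_col => x; rewrite -!mulmxA -!mul_Rmx g_iso.
Qed.

Lemma iso_by_sym g c d :
  g \in unitmx -> iso_by g c d -> iso_by (invmx g) d c.
Proof.
move=> gU g_iso x y; apply: (can_inj (mulKmx gU)).
by rewrite g_iso !mulKVmx.
Qed.

Lemma isomorphic_sym c d : isomorphic c d -> isomorphic d c.
Proof.
case=> g gU g_iso; exists (invmx g); rewrite ?unitmx_inv //.
exact: iso_by_sym.
Qed.

(** A structure given by a table is determined by its values on the basis, so
    this transport formula, which defines act on the basis, extends to all
    vectors by bilinearity. *)
Lemma mul_act g c x y :
  mul (act g c) x y = g *m mul c (invmx g *m x) (invmx g *m y).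
Proof.
pose h := invmx g.
have coordsE (z : V) (A : 'M[K]_3) : A *m z = \sum_j z j 0 *: (A *m e K j.+1).
  apply/colP=> k; rewrite !mxE summxE; apply: eq_bigr => j _; rewrite !mxE mulrC.
  congr (_ * _); rewrite -[LHS](sum_eE (A k)).
  by apply: eq_bigr => l _; rewrite mulrC.
rewrite -/h (mul_Lmx c) (coordsE y h) linear_sum linear_sum.
have Rx j : Lmx c (h *m x) *m (h *m e K j.+1) =
   \sum_i x i 0 *: mul c (h *m e K i.+1) (h *m e K j.+1).
  rewrite -mul_Lmx mul_Rmx (coordsE x h) linear_sum; apply: eq_bigr => i _ /=.
  by rewrite linearZ /= -mul_Rmx.
apply/colP => k; rewrite summxE mxE exchange_big; apply: eq_bigr => j _ /=.
rewrite -!scalemxAr mxE Rx linear_sum summxE big_distrr.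
by apply: eq_bigr => i _ /=; rewrite -scalemxAr mxE ffunE /=; ring.
Qed.

Lemma orbitP c d : orbit c d <-> isomorphic c d.
Proof.
split=> -[g gU g_cd]; exists g => //.
  by move=> x y; rewrite g_cd mul_act !mulKmx.
by apply: eq_sconsts => x y; rewrite mul_act g_cd !mulKVmx.
Qed.

(** * Closed conditions on the structure constants *)

Definition trL c x := \tr (Lmx c x).
Definition trR c y := \tr (Rmx c y).

Lemma trLE c x : trL c x =
  mul c x (e K 1) 0 0 + mul c x (e K 2) 1 0 + mul c x (e K 3) 2%:R 0.
Proof. by rewrite /trL /mxtrace sum3 !mxE. Qed.

Lemma trRE c y : trR c y =
  mul c (e K 1) y 0 0 + mul c (e K 2) y 1 0 + mul c (e K 3) y 2%:R 0.
Proof. by rewrite /trR /mxtrace sum3 !mxE. Qed.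

Lemma mxtrace_conj g (A B : 'M[K]_3) :
  g \in unitmx -> g *m A = B *m g -> \tr A = \tr B.
Proof.
by move=> gU gAB; rewrite -(mulKmx gU A) gAB mxtrace_mulC mulmxK.
Qed.

Lemma iso_trL g c d x : g \in unitmx -> iso_by g c d -> trL c x = trL d (g *m x).
Proof. by move=> gU /iso_Lmx g_iso; apply: mxtrace_conj gU (g_iso x). Qed.

Lemma iso_trR g c d y : g \in unitmx -> iso_by g c d -> trR c y = trR d (g *m y).
Proof. by move=> gU /iso_Rmx g_iso; apply: mxtrace_conj gU (g_iso y). Qed.

(** Subtracting the right trace removes the summand a phi(y) x from a product
    phi(x) T y + a phi(y) x without referring to a or phi.  The factor 3, the
    dimension, replaces a division. *)
Definition defect c x y : V := 3%:R *: mul c x y - trR c y *: x.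

Lemma defectE c x y k :
  defect c x y k 0 = 3%:R * mul c x y k 0 - trR c y * x k 0.
Proof. by rewrite subE [(_ *: mul c x y) _ _]mxE [(_ *: x) _ _]mxE. Qed.

Lemma iso_defect g c d x y : g \in unitmx -> iso_by g c d ->
  g *m defect c x y = defect d (g *m x) (g *m y).
Proof.
move=> gU g_iso; rewrite /defect mulmxBr -!scalemxAr g_iso.
by rewrite (iso_trR _ gU g_iso).
Qed.

Definition trace_ratio (a b : K) c := forall x, a * trL c x = b * trR c x.

(** Over a field this says that the defect is the product of a scalar function
    of x and a vector function of y: the 2 x 2 minors of the matrix with rows
    indexed by x and columns by y and a coordinate vanish.  The outer products
    u *m v^T collect all pairs of coordinates, which makes the condition
    visibly invariant under change of basis. *)
Definition rank_one_defect c := forall x x' y y',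
  defect c x y *m (defect c x' y')^T = defect c x' y *m (defect c x y')^T.

Definition square_zero_defect c := forall x x' y, defect c x (defect c x' y) = 0.

Lemma iso_trace_ratio a b c d :
  isomorphic c d -> trace_ratio a b c -> trace_ratio a b d.
Proof.
case/isomorphic_sym=> g gU g_iso cP x.
by rewrite (iso_trL _ gU g_iso) (iso_trR _ gU g_iso).
Qed.

Lemma iso_rank_one_defect c d :
  isomorphic c d -> rank_one_defect c -> rank_one_defect d.
Proof.
case/isomorphic_sym=> g gU g_iso cP x x' y y'; apply: (can_inj (mulKmx gU)).
have gTU : g^T \in unitmx by rewrite unitmx_tr.
apply: (can_inj (mulmxK gTU)).
by rewrite !mulmxA -[LHS]mulmxA -[RHS]mulmxA -!trmx_mul !(iso_defect _ _ gU g_iso).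
Qed.

Lemma iso_square_zero_defect c d :
  isomorphic c d -> square_zero_defect c -> square_zero_defect d.
Proof.
case/isomorphic_sym=> g gU g_iso cP x x' y; apply: (can_inj (mulKmx gU)).
by rewrite !(iso_defect _ _ gU g_iso) cP mulmx0.
Qed.

(** * Products phi(x) T y + a phi(y) x *)

Definition split_product (phi : 'rV[K]_3) (T : 'M[K]_3) (a : K) c :=
  phi *m T = 0 /\ forall x y,
  mul c x y = (phi *m x) 0 0 *: (T *m y) + (a * (phi *m y) 0 0) *: x.

Lemma mxtrace_row_col (u : V) (phi : 'rV[K]_3) : \tr (u *m phi) = (phi *m u) 0 0.
Proof. by rewrite mxtrace_mulC /mxtrace big_ord1. Qed.

(** Here L_x = phi(x) T + a x phi. *)
Lemma split_trL phi T a c x : split_product phi T a c ->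
  trL c x = (\tr T + a) * (phi *m x) 0 0.
Proof.
case=> _ cE; have -> : trL c x = \tr ((phi *m x) 0 0 *: T + a *: (x *m phi)).
  congr (\tr _); apply: eq_mulmx_col => y; rewrite -mul_Lmx cE mulmxDl.
  rewrite -!scalemxAl -mulmxA -scalerA; congr (_ + _ *: _).
  by rewrite [phi *m y]mx11_scalar mul_mx_scalar mxE eqxx.
rewrite linearD !linearZ /= mxtrace_row_col; ring.
Qed.

(** Here R_y = (T y) phi + a phi(y) 1, whose first summand has trace
    phi (T y) = 0. *)
Lemma split_trR phi T a c y : split_product phi T a c ->
  trR c y = 3%:R * a * (phi *m y) 0 0.
Proof.
case=> phiT cE; have -> : trR c y = \tr (T *m y *m phi + (a * (phi *m y) 0 0)%:M).
  congr (\tr _); apply: eq_mulmx_col => x; rewrite -mul_Rmx cE mulmxDl.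
  rewrite mul_scalar_mx -mulmxA; congr (_ + _).
  by rewrite [phi *m x]mx11_scalar mul_mx_scalar mxE eqxx.
rewrite linearD /= mxtrace_row_col mxtrace_scalar mulmxA phiT mul0mx mxE add0r.
by rewrite -mulr_natl; ring.
Qed.

Lemma split_defect phi T a c x y : split_product phi T a c ->
  defect c x y = (3%:R * (phi *m x) 0 0) *: (T *m y).
Proof.
move=> cS; rewrite /defect (split_trR _ cS) cS.2 scalerDr !scalerA.
by rewrite -[3%:R * a * _]mulrA addrK.
Qed.

Lemma split_trace_ratio phi T a c :
  split_product phi T a c -> trace_ratio (3%:R * a) (\tr T + a) c.
Proof. by move=> cS x; rewrite (split_trL _ cS) (split_trR _ cS) mulrCA. Qed.

Lemma split_rank_one_defect phi T a c :
  split_product phi T a c -> rank_one_defect c.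
Proof.
move=> cS x x' y y'; rewrite !(split_defect _ _ cS) !linearZ /=.
by rewrite -!scalemxAl !scalerA; congr (_ *: _); rewrite mulrC.
Qed.

Lemma split_square_zero_defect phi T a c :
  T *m T = 0 -> split_product phi T a c -> square_zero_defect c.
Proof.
move=> TT cS x x' y; rewrite !(split_defect _ _ cS) -scalemxAr mulmxA TT.
by rewrite mul0mx !scaler0.
Qed.

End Products.

(** * Zariski closure *)

Section Closure.
Variable K : fieldType.
Local Notation V := 'cV[K]_3.
Implicit Types (c d : sconsts K) (S : sconsts K -> Prop).

Definition polynomial_fun (F : sconsts K -> K) := exists p, forall c, peval p c = F c.

(** Vectors depending polynomially on the structure constants are needed because
    products are nested in square_zero_defect. *)
Definition polynomial_vec (X : sconsts K -> V) :=
  forall k, polynomial_fun (fun c => X c k 0).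

Lemma closure_vanish S (F G : sconsts K -> K) c :
    polynomial_fun F -> polynomial_fun G -> (forall d, S d -> F d = G d) ->
  zariski_closure S c -> F c = G c.
Proof.
case=> p pE [q qE] S0 /(_ (fun d => F d = G d)); apply=> //.
exists (fun r => r = p - q) => d; rewrite -pE -qE; split=> [pq _ ->|].
  by rewrite /peval mevalB; apply/eqP; rewrite subr_eq0; apply/eqP.
by move=> /(_ _ erefl)/eqP; rewrite /peval mevalB subr_eq0 => /eqP.
Qed.

Lemma polynomial_const a : polynomial_fun (fun=> a).
Proof. by exists a%:MP => c; rewrite /peval mevalC. Qed.

Lemma polynomial_coord i : polynomial_fun (fun c => c i).
Proof. by exists ('X_(enum_rank i)) => c; rewrite /peval mevalXU enum_rankK. Qed.

Lemma polynomialD F G : polynomial_fun F -> polynomial_fun G ->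
  polynomial_fun (fun c => F c + G c).
Proof.
by case=> p pE [q qE]; exists (p + q) => c; rewrite -pE -qE /peval mevalD.
Qed.

Lemma polynomialM F G : polynomial_fun F -> polynomial_fun G ->
  polynomial_fun (fun c => F c * G c).
Proof.
by case=> p pE [q qE]; exists (p * q) => c; rewrite -pE -qE /peval mevalM.
Qed.

Lemma polynomial_ext F G : F =1 G -> polynomial_fun F -> polynomial_fun G.
Proof. by move=> FG [p pE]; exists p => c; rewrite pE FG. Qed.

Lemma polynomial_sum (I : Type) (r : seq I) (F : I -> sconsts K -> K) :
  (forall i, polynomial_fun (F i)) -> polynomial_fun (fun c => \sum_(i <- r) F i c).
Proof.
move=> FP; elim: r => [|i r IHr].
  by apply: polynomial_ext (polynomial_const 0) => c; rewrite big_nil.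
by apply: polynomial_ext (polynomialD (FP i) IHr) => c; rewrite big_cons.
Qed.

Lemma polynomial_vec_const x : polynomial_vec (fun=> x).
Proof. by move=> k; apply: polynomial_const. Qed.

Lemma polynomial_mul X Y : polynomial_vec X -> polynomial_vec Y ->
  polynomial_vec (fun c => mul c (X c) (Y c)).
Proof.
move=> XP YP k.
have P : polynomial_fun
    (fun c => \sum_i \sum_j X c i 0 * Y c j 0 * c (i, j, k)).
  apply: polynomial_sum => i; apply: polynomial_sum => j.
  by apply: polynomialM (polynomial_coord _); apply: polynomialM.
by apply: polynomial_ext P => c; rewrite [RHS]mxE.
Qed.

Lemma polynomial_trL X : polynomial_vec X -> polynomial_fun (fun c => trL c (X c)).
Proof.
move=> XP; apply: polynomial_sum => k.
apply: (@polynomial_ext (fun c => mul c (X c) (e K k.+1) k 0)).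
  by move=> c; rewrite [RHS]mxE.
exact: (polynomial_mul XP (polynomial_vec_const _)).
Qed.

Lemma polynomial_trR Y : polynomial_vec Y -> polynomial_fun (fun c => trR c (Y c)).
Proof.
move=> YP; apply: polynomial_sum => k.
apply: (@polynomial_ext (fun c => mul c (e K k.+1) (Y c) k 0)).
  by move=> c; rewrite [RHS]mxE.
exact: (polynomial_mul (polynomial_vec_const _) YP).
Qed.

Lemma polynomial_defect X Y : polynomial_vec X -> polynomial_vec Y ->
  polynomial_vec (fun c => defect c (X c) (Y c)).
Proof.
move=> XP YP k.
have P : polynomial_fun
    (fun c => 3%:R * mul c (X c) (Y c) k 0 + -1 * (trR c (Y c) * X c k 0)).
  apply: polynomialD.
    exact: polynomialM (polynomial_const _) (polynomial_mul XP YP k).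
  apply: polynomialM (polynomial_const _) _.
  exact: polynomialM (polynomial_trR YP) (XP k).
by apply: polynomial_ext P => c; rewrite defectE mulN1r.
Qed.

Lemma closure_trace_ratio a b S c : (forall d, S d -> trace_ratio a b d) ->
  zariski_closure S c -> trace_ratio a b c.
Proof.
move=> SP Sc x.
apply: (@closure_vanish S (fun d => a * trL d x) (fun d => b * trR d x) c _ _ _ Sc);
  last by move=> d /SP.
  exact: polynomialM (polynomial_const _) (polynomial_trL (polynomial_vec_const _)).
exact: polynomialM (polynomial_const _) (polynomial_trR (polynomial_vec_const _)).
Qed.

Lemma closure_rank_one_defect S c : (forall d, S d -> rank_one_defect d) ->
  zariski_closure S c -> rank_one_defect c.
Proof.
move=> SP Sc x x' y y'; apply/matrixP => i j.
pose F u v u' v' d := (defect d u v *m (defect d u' v')^T) i j.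
have FP u v u' v' : polynomial_fun (F u v u' v').
  apply: (@polynomial_ext (fun d => defect d u v i 0 * defect d u' v' j 0)).
    by move=> d; rewrite /F [RHS]mxE big_ord1 [_^T _ _]mxE.
  have cP x0 : polynomial_vec (fun=> x0) by apply: polynomial_vec_const.
  exact: polynomialM (polynomial_defect (cP u) (cP v) i)
                     (polynomial_defect (cP u') (cP v') j).
apply: (closure_vanish (FP x y x' y') (FP x' y x y') _ Sc) => d /SP dP.
by rewrite /F dP.
Qed.

Lemma closure_square_zero_defect S c : (forall d, S d -> square_zero_defect d) ->
  zariski_closure S c -> square_zero_defect c.
Proof.
move=> SP Sc x x' y; apply/colP => k; rewrite [RHS]mxE.
have FP : polynomial_fun (fun d => defect d x (defect d x' y) k 0).
  apply: (polynomial_defect (polynomial_vec_const _)).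
  exact: (polynomial_defect (polynomial_vec_const _) (polynomial_vec_const _)).
by apply: (closure_vanish FP (polynomial_const 0) _ Sc) => d /SP->; rewrite mxE.
Qed.

End Closure.

Section Line.
Variable K : numFieldType.
Implicit Types (c d : sconsts K) (S : sconsts K -> Prop).

(** In characteristic zero the nonzero naturals provide enough roots. *)
Lemma poly_eq0_off0 (q : {poly K}) : (forall t, t != 0 -> q.[t] = 0) -> q = 0.
Proof.
move=> q0; apply/eqP/negPn/negP => qN0.
pose s : seq K := [seq i.+1%:R | i <- iota 0 (size q)].
have /(max_poly_roots qN0) : all (root q) s.
  by apply/allP => _ /mapP[i _ ->]; apply/rootP/q0; rewrite pnatr_eq0.
rewrite map_inj_uniq ?iota_uniq => [/(_ isT)|i j /eqP].
  by rewrite size_map size_iota ltnn.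
by rewrite eqr_nat => /eqP[].
Qed.

(** Along a line, a polynomial in the structure constants becomes a polynomial in
    one variable; with infinitely many roots it is zero, hence vanishes at the
    base point as well. *)
Lemma closure_line S c d (l : K -> sconsts K) :
    (forall t, t != 0 -> S (l t)) -> (forall t i, l t i = c i + t * d i) ->
  zariski_closure S c.
Proof.
move=> Sl lE Z [P ZP] SZ; apply/ZP => p Pp.
pose v (i : 'I_#|{: 'I_3 * 'I_3 * 'I_3}|) : {poly K} :=
  (c (enum_val i))%:P + (d (enum_val i))%:P * 'X.
pose q := \sum_(m <- msupp p) p@_m *: \prod_i v i ^+ m i.
have qE t : q.[t] = peval p (l t).
  rewrite /peval mevalE horner_sum; apply: eq_bigr => m _.
  rewrite hornerZ horner_prod; congr (_ * _); apply: eq_bigr => i _.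
  by rewrite horner_exp !hornerE lE mulrC.
have q0 : q = 0.
  by apply: poly_eq0_off0 => t tN0; rewrite qE; have /SZ/ZP := Sl t tN0; apply.
have -> : c = l 0 by apply/ffunP => i; rewrite lE mul0r addr0.
by rewrite -qE q0 horner0.
Qed.

End Line.

(** * Degenerations of the algebras of type D *)

Section Algebras.
Variable K : numFieldType.
Local Notation V := 'cV[K]_3.

(** The isomorphisms from a degenerating line to an algebra of type D send the
    kernel of phi, spanned by e1 and e3, to that of type D, spanned by e3 and
    e2; hence this shape. *)
Definition frame (a b c p q : K) : 'M[K]_3 := \matrix_(i, j)
  match nat_of_ord i, nat_of_ord j with
  | 0%N, 1%N => a
  | 1%N, 1%N => b
  | 1%N, 2%N => c
  | 2%N, 0%N => p
  | 2%N, 1%N => q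
  | _, _ => 0
  end.

Lemma frameE a b c p q (x : V) :
  ((frame a b c p q *m x) 0 0 = a * x 1 0) *
  ((frame a b c p q *m x) 1 0 = b * x 1 0 + c * x 2%:R 0) *
  ((frame a b c p q *m x) 2%:R 0 = p * x 0 0 + q * x 1 0).
Proof. by do !split; rewrite mxE sum3 !mxE /=; ring. Qed.

Lemma frame_unit a b c p q :
  a != 0 -> c != 0 -> p != 0 -> frame a b c p q \in unitmx.
Proof.
move=> aN0 cN0 pN0.
pose h : 'M[K]_3 := \matrix_(i, j)
  match nat_of_ord i, nat_of_ord j with
  | 0%N, 0%N => - q / (p * a)
  | 0%N, 2%N => p^-1
  | 1%N, 0%N => a^-1
  | 2%N, 0%N => - b / (c * a)
  | 2%N, 1%N => c^-1
  | _, _ => 0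
  end.
suff /mulmx1_unit[] : frame a b c p q *m h = 1%:M by [].
apply: eq_mulmx_col => y; rewrite mul1mx -mulmxA.
apply/colP; apply: ord3_ind; rewrite frameE !mxE !sum3 !mxE /=; field;
  by rewrite ?aN0 ?cN0 ?pN0.
Qed.

(** With phi the second coordinate form, this is the product
    phi(x) S' y + a phi(y) x where S' maps e1 to l e1, e2 to s e1 and e3
    to l e3. *)
Definition direction (a l s : K) : sconsts K := table (fun i j => match i, j with
  | 1%N, 2%N => a *: e K 1
  | 2%N, 1%N => l *: e K 1
  | 2%N, 2%N => s *: e K 1 + a *: e K 2
  | 2%N, 3%N => l *: e K 3
  | 3%N, 2%N => a *: e K 3
  | _, _ => 0
  end).

Lemma direction_mul a l s (x y : V) :
  (mul (direction a l s) x y 0 0 =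
     l * x 1 0 * y 0 0 + a * x 0 0 * y 1 0 + s * x 1 0 * y 1 0) *
  (mul (direction a l s) x y 1 0 = a * x 1 0 * y 1 0) *
  (mul (direction a l s) x y 2%:R 0 = l * x 1 0 * y 2%:R 0 + a * x 2%:R 0 * y 1 0).
Proof. by do !split; rewrite mul_table !mxE /=; ring. Qed.

Definition line (c d : sconsts K) (t : K) : sconsts K := [ffun i => c i + t * d i].

Lemma line_mul c d t (x y : V) k :
  mul (line c d t) x y k 0 = mul c x y k 0 + t * mul d x y k 0.
Proof.
rewrite 3![mul _ _ _ _ _]mxE big_distrr -big_split; apply: eq_bigr => i _ /=.
rewrite big_distrr -big_split; apply: eq_bigr => j _ /=.
by rewrite ffunE; ring.
Qed.

Lemma line_degeneration (A c d : sconsts K) :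
  (forall t, t != 0 -> isomorphic (line c d t) A) -> zariski_closure (orbit A) c.
Proof.
move=> cdA; apply: (closure_line (l := line c d) (d := d)) => [t tN0|t i].
  by apply/orbitP/isomorphic_sym/cdA.
by rewrite ffunE.
Qed.

(** The scaled form t phi takes the value 1 at e2 / t, where T = S / t is
    nilpotent with e2 / t -> e1 / t^2 -> - e3 / t^3; these three vectors are the
    images of e1, e3, e2 of D1. *)
Lemma D1_degenerates_B4 : zariski_closure (orbit (@D1 K)) (B4_table 0).
Proof.
apply: (@line_degeneration _ _ (direction (-1) 0 0)) => t tN0.
exists (frame t 0 (- t ^+ 3) (t ^+ 2) 0).
  by rewrite frame_unit ?oppr_eq0 ?expf_neq0.
move=> x y; apply/colP; apply: ord3_ind;
  rewrite D1_mul !frameE !line_mul !B4_mul !direction_mul; ring.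
Qed.

(** The limit has S e2 = 0, but the operator of D1 has rank 2; the last argument
    of direction restores the rank of S / t + S' by S' e2 = e1. *)
Lemma D1_degenerates_B5 : zariski_closure (orbit (@D1 K)) (B5_table 0).
Proof.
apply: (@line_degeneration _ _ (direction (-1) 0 1)) => t tN0.
exists (frame t 0 (- t ^+ 2) t 0).
  by rewrite frame_unit ?oppr_eq0 ?expf_neq0.
move=> x y; apply/colP; apply: ord3_ind;
  rewrite D1_mul !frameE !line_mul !B5_mul !direction_mul; ring.
Qed.

(** Taking S' to be l = a + 1 on the span of e1 and e3 turns the nilpotent block
    of S / t into the Jordan block of D2(a).  The vector e1 of D2(a) corresponds
    to one spanning the kernel of S / t + S', and solving for this kernel
    divides by l. *)
Lemma D2_degenerates_B4 (a : K) : a <> -1 ->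
  zariski_closure (orbit (D2 a)) (B4_table 0).
Proof.
move=> /eqP; rewrite -subr_eq0 opprK => lN0.
apply: (@line_degeneration _ _ (direction a (a + 1) 0)) => t tN0.
exists (frame t (- ((a + 1) ^+ 2 * t)^-1) (- t) 1 ((a + 1) * t)^-1).
  by rewrite frame_unit ?oppr_eq0 ?oner_eq0.
move=> x y; apply/colP; apply: ord3_ind;
  rewrite D2_mul !frameE !line_mul !B4_mul !direction_mul; field;
  by rewrite ?tN0 ?lN0.
Qed.

(** As S e2 = 0 here, e2 itself lies in the kernel of S / t + S' and corresponds
    to e1 of D2(a) up to scaling; no division by a + 1 occurs. *)
Lemma D2_degenerates_B5 (a : K) : zariski_closure (orbit (D2 a)) (B5_table 0).
Proof.
apply: (@line_degeneration _ _ (direction a (a + 1) 0)) => t tN0.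
exists (frame t 0 (- t) 1 0).
  by rewrite frame_unit ?oppr_eq0 ?oner_eq0.
move=> x y; apply/colP; apply: ord3_ind;
  rewrite D2_mul !frameE !line_mul !B5_mul !direction_mul; ring.
Qed.

(** * Obstructions *)

Definition D1_op : 'M[K]_3 := delta_mx 2%:R 0 + delta_mx 1 2%:R.
Definition D2_op (a : K) : 'M[K]_3 :=
  (a + 1) *: (delta_mx 1 1 + delta_mx 2%:R 2%:R) + delta_mx 1 2%:R.

Lemma D1_split : split_product (e K 1)^T D1_op (-1) D1.
Proof.
split; first by apply/rowP; apply: ord3_ind; rewrite mxE sum3 !mxE /=; ring.
move=> x y; apply/colP; apply: ord3_ind;
  rewrite D1_mul !mxE !sum3 !mxE /=; ring.
Qed.

Lemma D2_split a : split_product (e K 1)^T (D2_op a) a (D2 a).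
Proof.
split; first by apply/rowP; apply: ord3_ind; rewrite mxE sum3 !mxE /=; ring.
move=> x y; apply/colP; apply: ord3_ind;
  rewrite D2_mul !mxE !sum3 !mxE /=; ring.
Qed.

Lemma mxtrace_D1_op : \tr D1_op = 0.
Proof. by rewrite /mxtrace sum3 !mxE /=; ring. Qed.

Lemma mxtrace_D2_op a : \tr (D2_op a) = 2%:R * (a + 1).
Proof. by rewrite /mxtrace sum3 !mxE /=; ring. Qed.

Lemma D2_op_square_zero : D2_op (-1) *m D2_op (-1) = 0.
Proof.
apply/matrixP; apply: ord3_ind; apply: ord3_ind; rewrite mxE sum3 !mxE /=; ring.
Qed.

Lemma lies_in_boundary_trace_ratio a b (A B : novikovAlg K) :
  lies_in_boundary B A -> trace_ratio a b A -> trace_ratio a b B.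
Proof.
case=> c cB [Ac _] AP; apply: iso_trace_ratio cB _.
by apply: closure_trace_ratio Ac => d /orbitP/iso_trace_ratio; apply.
Qed.

Lemma lies_in_boundary_rank_one_defect (A B : novikovAlg K) :
  lies_in_boundary B A -> rank_one_defect A -> rank_one_defect B.
Proof.
case=> c cB [Ac _] AP; apply: iso_rank_one_defect cB _.
by apply: closure_rank_one_defect Ac => d /orbitP/iso_rank_one_defect; apply.
Qed.

Lemma lies_in_boundary_square_zero_defect (A B : novikovAlg K) :
  lies_in_boundary B A -> square_zero_defect A -> square_zero_defect B.
Proof.
case=> c cB [Ac _] AP; apply: iso_square_zero_defect cB _.
by apply: closure_square_zero_defect Ac => d /orbitP/iso_square_zero_defect; apply.
Qed.

(** This isomorphism invariant holds for B4(0) and B5(0) but for no algebra of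
    type D, so it shows that the limits lie outside the orbits. *)
Definition traceless (c : sconsts K) := forall x, trL c x = 0 /\ trR c x = 0.

Lemma iso_traceless (c d : sconsts K) :
  isomorphic c d -> traceless c -> traceless d.
Proof.
case/isomorphic_sym=> g gU g_iso c0 x.
by rewrite (iso_trL _ gU g_iso) (iso_trR _ gU g_iso).
Qed.

Lemma split_traceless (phi : 'rV[K]_3) T a (c : sconsts K) :
  phi != 0 -> split_product phi T a c -> traceless c -> a = 0 /\ \tr T = 0.
Proof.
move=> phiN0 cS c0; have [j phijN0] : exists j, phi 0 j != 0.
  by apply/existsP; apply: contraNT phiN0 => /existsPn phi0;
     apply/eqP/rowP => j; rewrite mxE; apply/eqP/negPn/phi0.
have [/eqP] := c0 (delta_mx j 0).
rewrite (split_trL _ cS) (split_trR _ cS) -colE mxE mulf_eq0 (negPf phijN0) orbF.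
move=> /eqP Ta0 /eqP; rewrite !mulf_eq0 pnatr_eq0 (negPf phijN0) orbF /=.
by move=> /eqP a0; move: Ta0; rewrite a0 addr0.
Qed.

Lemma degeneration_lies_in_boundary (A B C : novikovAlg K) :
    traceless C -> ~ traceless A -> zariski_closure (orbit A) C ->
  isomorphic B C -> lies_in_boundary B A.
Proof.
move=> C0 AN0 AC /isomorphic_sym BC; exists (alg_sconsts C) => //; split=> //.
by move/orbitP/isomorphic_sym/iso_traceless/(_ C0).
Qed.

Lemma B4_traceless a : traceless (B4_table (a : K)).
Proof. by move=> x; rewrite trLE trRE !B4_mul !mxE /=; split; ring. Qed.

Lemma B5_traceless b : traceless (B5_table (b : K)).
Proof. by move=> x; rewrite trLE trRE !B5_mul !mxE /=; split; ring. Qed.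

Lemma B3_traceless : traceless (@B3_table K).
Proof. by move=> x; rewrite trLE trRE !B3_mul !mxE /=; split; ring. Qed.

Lemma e1_neq0 : (e K 1)^T != 0.
Proof. by apply/eqP => /rowP/(_ 0); rewrite !mxE /=; apply/eqP/oner_neq0. Qed.

Lemma D1_not_traceless : ~ traceless (@D1 K).
Proof.
move=> /(split_traceless e1_neq0 D1_split)[/eqP].
by rewrite oppr_eq0 oner_eq0.
Qed.

Lemma D2_not_traceless a : ~ traceless (D2 (a : K)).
Proof.
move=> /(split_traceless e1_neq0 (D2_split a))[-> /eqP].
by rewrite mxtrace_D2_op add0r mulr1 pnatr_eq0.
Qed.

Lemma traceless_defect c x y : traceless c -> defect c x y = 3%:R *: mul c x y.
Proof. by move=> c0; rewrite /defect (c0 y).2 scale0r subr0. Qed.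

Lemma isomorphic_refl (c : sconsts K) : isomorphic c c.
Proof. by exists 1%:M; rewrite ?unitmx1 // => x y; rewrite !mul1mx. Qed.

(** Exchange e1 and e2, and change the sign of e3. *)
Lemma B5_1_isomorphic_B5_0 : isomorphic (B5_table (1 : K)) (B5_table 0).
Proof.
pose g : 'M[K]_3 := \matrix_(i, j)
  match nat_of_ord i, nat_of_ord j with
  | 0%N, 1%N | 1%N, 0%N => 1
  | 2%N, 2%N => -1
  | _, _ => 0
  end.
have gE (x : V) : ((g *m x) 0 0 = x 1 0) * ((g *m x) 1 0 = x 0 0) *
    ((g *m x) 2%:R 0 = - x 2%:R 0).
  by do !split; rewrite mxE sum3 !mxE /=; ring.
exists g => [|x y]; last first.
  by apply/colP; apply: ord3_ind; rewrite B5_mul !gE !B5_mul; ring.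
suff /mulmx1_unit[] : g *m g = 1%:M by [].
apply: eq_mulmx_col => y; rewrite mul1mx -mulmxA.
by apply/colP; apply: ord3_ind; rewrite !gE ?opprK.
Qed.

Lemma trace_ratio_B1 a b : trace_ratio a b (@B1_table K) -> a = b.
Proof.
move=> /(_ (e K 1)); rewrite trLE trRE !B1_mul !mxE /=.
rewrite !(mul1r, mul0r, add0r, addr0, mulr0).
by apply: mulIf; rewrite -!natrD pnatr_eq0.
Qed.

Lemma trace_ratio_B2 a b : trace_ratio a b (@B2_table K) -> a = b.
Proof.
move=> /(_ (e K 1)); rewrite trLE trRE !B2_mul !mxE /=.
rewrite !(mul1r, mul0r, add0r, addr0, mulr0).
by apply: mulIf; rewrite -!natrD pnatr_eq0.
Qed.

(** For traceless products the defect is 3 times the product, so the minors of the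
    product itself vanish.  The next three lemmas each use one minor. *)
Lemma rank_one_defect_mul c x x' y y' i j : traceless c -> rank_one_defect c ->
  mul c x y i 0 * mul c x' y' j 0 = mul c x' y i 0 * mul c x y' j 0.
Proof.
move=> c0 /(_ x x' y y')/matrixP/(_ i j).
rewrite !traceless_defect // !linearZ /= -!scalemxAl !scalerA.
rewrite [LHS]mxE [RHS]mxE => /(mulfI _).
rewrite ![(_ *m _) _ _]mxE !big_ord1 ![_^T _ _]mxE; apply.
by rewrite mulf_neq0 ?pnatr_eq0.
Qed.

Lemma rank_one_defect_B3 : ~ rank_one_defect (@B3_table K).
Proof.
move=> /(rank_one_defect_mul (e K 1) (e K 2) (e K 2) (e K 1) 2%:R 2%:R B3_traceless).
rewrite !B3_mul !mxE /= !(mul1r, mul0r, mulr1, mulr0, addr0, add0r, sub0r, subr0).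
by move/eqP; rewrite oppr0 mulr0 mulrN oppr_eq0 mulf_eq0 invr_eq0 pnatr_eq0.
Qed.

Lemma rank_one_defect_B4 a : rank_one_defect (B4_table (a : K)) -> a = 0.
Proof.
move=> /(rank_one_defect_mul (e K 1) (e K 2) (e K 2) (e K 2) 2%:R 0 (B4_traceless a)).
rewrite !B4_mul !mxE /=.
by rewrite !(mul1r, mul0r, mulr1, mulr0, addr0, add0r, sub0r, subr0).
Qed.

Lemma rank_one_defect_B5 b : rank_one_defect (B5_table (b : K)) -> b = 0 \/ b = 1.
Proof.
move=> /(rank_one_defect_mul (e K 1) (e K 2) (e K 2) (e K 1) 2%:R 2%:R (B5_traceless b)).
rewrite !B5_mul !mxE /= !(mul1r, mul0r, mulr1, mulr0, addr0, add0r, sub0r, subr0).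
move/eqP; rewrite mulf_eq0 subr_eq0.
by case/orP=> /eqP; [left | right].
Qed.

Lemma square_zero_defect_mul c x x' y : traceless c -> square_zero_defect c ->
  mul c x (mul c x' y) = 0.
Proof.
move=> c0 /(_ x x' y)/eqP; rewrite !traceless_defect // (mul_Lmx c x) -scalemxAr.
by rewrite !scaler_eq0 pnatr_eq0 -mul_Lmx => /eqP.
Qed.

(** e2 (e2 e2) = e2 e1 = - e3. *)
Lemma square_zero_defect_B4 : ~ square_zero_defect (B4_table (0 : K)).
Proof.
move=> /(square_zero_defect_mul (e K 2) (e K 2) (e K 2) (B4_traceless 0)).
move=> /colP/(_ 2%:R); rewrite !B4_mul !mxE /=; apply/eqP.
by rewrite !(mul1r, mul0r, mulr1, add0r) oppr_eq0 oner_eq0.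
Qed.

(** In B1 and B2, tr L = tr R takes a nonzero value, so the trace relation would
    force 3 a = tr T + a. *)
Lemma boundary_typeB phi T a (A B : novikovAlg K) :
    split_product phi T a A -> 2%:R * a != \tr T ->
    typeB B -> lies_in_boundary B A ->
  isomorphic B (B4 0) \/ isomorphic B (B5 0).
Proof.
move=> AS aT BB AB.
have ratioN : 3%:R * a <> \tr T + a.
  by move=> tE; case/eqP: aT; apply/(addIr a); rewrite -tE; ring.
have Btr := lies_in_boundary_trace_ratio AB (split_trace_ratio AS).
have Brk := lies_in_boundary_rank_one_defect AB (split_rank_one_defect AS).
case: BB Btr Brk {AB} => [|||b|b] Btr Brk.
- by case: ratioN; apply: trace_ratio_B1.
- by case: ratioN; apply: trace_ratio_B2.
- by case: rank_one_defect_B3.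
- by left; rewrite (rank_one_defect_B4 Brk); apply: isomorphic_refl.
- right; case: (rank_one_defect_B5 Brk) => ->; first exact: isomorphic_refl.
  exact: B5_1_isomorphic_B5_0.
Qed.

Lemma boundary_typeB_iff (B : novikovAlg K) : typeB B ->
  (lies_in_boundary B D1 <-> isomorphic B (B4 0) \/ isomorphic B (B5 0)) /\
  (forall alpha : K, alpha <> -1 ->
     (lies_in_boundary B (D2 alpha) <->
        isomorphic B (B4 0) \/ isomorphic B (B5 0))) /\
  (lies_in_boundary B (D2 (-1)) <-> isomorphic B (B5 0)).
Proof.
move=> hB.
have D2gap (alpha : K) : 2%:R * alpha != \tr (D2_op alpha).
  rewrite mxtrace_D2_op -subr_eq0.
  have -> : 2%:R * alpha - 2%:R * (alpha + 1) = - 2%:R by ring.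
  by rewrite oppr_eq0 pnatr_eq0.
have D2B alpha := boundary_typeB (D2_split alpha) (D2gap alpha) hB.
have toB5 := degeneration_lies_in_boundary (C := B5 0) (B5_traceless 0).
have toB4 := degeneration_lies_in_boundary (C := B4 0) (B4_traceless 0).
split; [|split=> [alpha alphaN|]].
- split=> [|[]].
  + apply: (boundary_typeB D1_split _ hB).
    by rewrite mxtrace_D1_op mulrN1 oppr_eq0 pnatr_eq0.
  + exact: toB4 _ _ D1_not_traceless D1_degenerates_B4.
  + exact: toB5 _ _ D1_not_traceless D1_degenerates_B5.
- split=> [|[]]; first exact: D2B.
  + exact: toB4 _ _ (@D2_not_traceless _) (D2_degenerates_B4 alphaN).
  + exact: toB5 _ _ (@D2_not_traceless _) (@D2_degenerates_B5 _).
split=> [BD2|]; last exact: toB5 _ _ (@D2_not_traceless _) (@D2_degenerates_B5 _).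
have [BB4|//] := D2B (-1) BD2.
have Bsq := split_square_zero_defect D2_op_square_zero (D2_split (-1)).
have := lies_in_boundary_square_zero_defect BD2 Bsq.
by move/(iso_square_zero_defect BB4)/square_zero_defect_B4.
Qed.

End Algebras.

Theorem proposition4p11 (R : realType) (B : novikovAlg R[i]) (hB : typeB B) :
  (lies_in_boundary B D1 <-> isomorphic B (B4 0) \/ isomorphic B (B5 0)) /\
  (forall alpha : R[i], alpha <> -1 ->
     (lies_in_boundary B (D2 alpha) <->
        isomorphic B (B4 0) \/ isomorphic B (B5 0))) /\
  (lies_in_boundary B (D2 (-1)) <-> isomorphic B (B5 0)).
Proof. exact: boundary_typeB_iff. Qed.
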